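(* For every $\alpha>1$ (and every choice of orthonormal bases $\{a_{v,j}\}_{j=1}^{q-1}$ of the spaces $Z_v$, $v\in\mathfrak X$), the family $$\mathcal S=\{g_{v,j}: v\in\mathfrak X,\ j=1,\dots,q-1\}$$ is a complete orthogonal system for the horocyclic harmonic Bergman space $\mathcal B^2_\alpha$.
   Context: Tree. Let $q\ge 2$ be an integer and let $\mathfrak X$ be (the vertex set of) the $q$-homogeneous tree: the connected graph without cycles in which every vertex has exactly $q+1$ neighbours ($x\sim y$ means $x,y$ are neighbours); $d$ is the edge-counting distance, $\mathbb N=\{0,1,2,\dots\}$. An infinite chain is a sequence $(x_i)_{i\in\mathbb N}$ with $x_i\sim x_{i+1}$ and $x_i\ne x_{i+2}$; two infinite chains $(x_i),(y_j)$ are equivalent if for some $m\in\mathbb Z$ one has $x_i=y_{i+m}$ eventually; a boundary point is an equivalence class. Fix a boundary point $\omega$. For $x\in\mathfrak X$, $[x,\omega)$ is the infinite chain starting at $x$ in the class $\omega$ and $x\wedge y$ is the vertex $z$ with $[x,\omega)\cap[y,\omega)=[z,\omega)$. Vertices $x,y$ lie on the same horocycle if $d(x,x\wedge y)=d(y,x\wedge y)$. Fix a horocycle $H_0$ and, for $k\in\mathbb Z$, let $H_k=\{x: d(x,x\wedge y)=d(y,x\wedge y)+k \text{ for some } y\in H_0\}$; the $H_k$ partition $\mathfrak X$. The horocyclic index $h(x)$ is the integer with $x\in H_{h(x)}$. The predecessor $p(x)$ is the only neighbour of $x$ in $H_{h(x)-1}$; the set $S(x)$ of successors consists of the other $q$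 neighbours, which lie in $H_{h(x)+1}$; $p^n$ is the $n$-th iterate of $p$ ($p^0=\mathrm{id}$). $U_x=\{y:[x,\omega)\subseteq[y,\omega)\}$ is the sector generated by $x$ and $\dot U_x=U_x\setminus\{x\}$. Spaces. $f:\mathfrak X\to\mathbb C$ is harmonic if $f(x)=\frac1{q+1}\sum_{y\sim x}f(y)$ for all $x\in\mathfrak X$. For $\alpha>1$, $\sigma_\alpha(x)=q^{-\alpha h(x)}$, and $\mathcal B^2_\alpha$ is the space of harmonic $f:\mathfrak X\to\mathbb C$ with $\sum_{x}|f(x)|^2\sigma_\alpha(x)<\infty$, with inner product $\langle f,g\rangle=\sum_x f(x)\overline{g(x)}\sigma_\alpha(x)$. The functions $g_{v,j}$. For $v\in\mathfrak X$ let $Z_v=\{\phi:S(v)\to\mathbb C:\ \sum_{x\in S(v)}\phi(x)=0\}$, a $(q-1)$-dimensional space with the inner product $\sum_{x\in S(v)}\phi(x)\overline{\psi(x)}$, and let $\{a_{v,j}: j=1,\dots,q-1\}$ be an orthonormal basis of $Z_v$. Define $g_{v,j}:\mathfrak X\to\mathbb C$ by $g_{v,j}(x)=0$ if $x\notin\dot U_v$ and $$g_{v,j}(x)=\Bigl(\sum_{i=0}^{h(x)-h(v)-1}q^{-i}\Bigr)a_{v,j}\bigl(p^{h(x)-h(v)-1}(x)\bigr)\quad\text{if }x\in\dot U_v .$$ ''Complete orthogonal system'' means: a family of elements of $\mathcal B^2_\alpha$ that are nonzero, pairwise orthogonal, and such that the only element of $\mathcal B^2_\alpha$ orthogonal to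 all of them is $0$. *)

(* Defs.v *)
From HB Require Import structures.
From mathcomp Require Export all_boot all_order all_algebra.
From mathcomp Require Export all_classical all_reals all_analysis.
From mathcomp Require Export complex.

Set Implicit Arguments.
Unset Strict Implicit.
Unset Printing Implicit Defensive.

Import Order.TTheory GRing.Theory Num.Theory.

Local Open Scope classical_set_scope.
Local Open Scope card_scope.
Local Open Scope ring_scope.

Section Graph.
Variables (T : choiceType) (adj : rel T).

Definition joins (x y : T) (s : seq T) : Prop := path adj x s /\ last x s = y.

(* A cycle has at least three vertices: an edge followed back and forth is a
   [ucycle] of size 2. *)
Record homogeneous_tree (q : nat) : Prop := HomogeneousTree {
  adj_symmetric : symmetric adj;
  adj_irreflexive : irreflexive adj;
  adj_connected : forall x y, exists s, joins x y s;
  adj_acyclic : forall c : seq T, (2 < size c)%N -> ~ ucycle adj c;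
  adj_degree : forall x, [set y | adj x y] #= `I_q.+1
}.

Definition walk_length (x y : T) : set nat :=
  [set n | exists2 s, joins x y s & size s = n].

Definition dist (x y : T) : nat :=
  xget 0%N [set n | walk_length x y n /\
                    forall m, walk_length x y m -> (n <= m)%N].

Definition infinite_chain (c : nat -> T) : Prop :=
  forall i, adj (c i) (c i.+1) /\ c i <> c i.+2.

Definition chain_equiv (c c' : nat -> T) : Prop :=
  exists (m : int) (N : nat), forall i j : nat,
    (N <= i)%N -> j%:Z = i%:Z + m -> c i = c' j.

Definition boundary_point (w : set (nat -> T)) : Prop :=
  exists2 c, infinite_chain c &
    w = [set c' | infinite_chain c' /\ chain_equiv c c'].

End Graph.

Section Horocycles.
Variables (T : choiceType) (adj : rel T) (w : set (nat -> T)).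

(* In the definitions below [xget] only picks elements which, for a boundary
   point w of a homogeneous tree, exist and are unique; its first argument is
   an irrelevant default. *)

Definition ray (x : T) : nat -> T :=
  xget (fun=> x) [set c | w c /\ c 0%N = x].

Definition ray_set (x : T) : set T := range (ray x).

Definition confluent (x y : T) : T :=
  xget x [set z | ray_set x `&` ray_set y = ray_set z].

Definition same_horocycle (x y : T) : Prop :=
  dist adj x (confluent x y) = dist adj y (confluent x y).

Definition horocycle (H : set T) : Prop :=
  exists x, H = [set y | same_horocycle x y].

Definition sector (x : T) : set T := [set y | ray_set x `<=` ray_set y].

Definition punctured_sector (x : T) : set T := sector x `\ x.

Variable H0 : set T.

Definition horo (k : int) : set T :=
  [set x | exists2 y, H0 y &
     (dist adj x (confluent x y))%:Z = (dist adj y (confluent x y))%:Z + k].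

Definition hindex (x : T) : int := xget 0 [set k | horo k x].

Definition predecessor (x : T) : T :=
  xget x [set y | adj x y /\ horo (hindex x - 1) y].

Definition successors (x : T) : set T :=
  [set y | adj x y /\ y <> predecessor x].

End Horocycles.

Section Bergman.
Variables (R : realType) (T : choiceType) (adj : rel T).
Variables (q : nat) (w : set (nat -> T)) (H0 : set T).

Definition harmonic (f : T -> R[i]) : Prop :=
  forall x, f x = (q.+1)%:R^-1 * \sum_(y \in [set y | adj x y]) f y.

Definition weight (alpha : R) (x : T) : R :=
  (q%:R : R) `^ (- alpha * (hindex adj w H0 x)%:~R).

Definition bergman (alpha : R) : set (T -> R[i]) :=
  [set f | harmonic f /\
     (\esum_(x in [set: T])
        ((Normc.normc (f x)) ^+ 2 * weight alpha x)%:E < +oo)%E].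

(* Sum of an absolutely summable family: the difference of the sums of the
   positive and of the negative parts, and componentwise over R[i]. *)
Definition real_sum (F : T -> R) : R :=
  fine (\esum_(x in [set: T]) ((EFin \o F)^\+ x)%E) -
  fine (\esum_(x in [set: T]) ((EFin \o F)^\- x)%E).

Definition complex_sum (F : T -> R[i]) : R[i] :=
  Complex (real_sum (fun x => complex.Re (F x)))
          (real_sum (fun x => complex.Im (F x))).

Definition inner (alpha : R) (f g : T -> R[i]) : R[i] :=
  complex_sum (fun x => f x * (g x)^* * (weight alpha x)%:C%C).

(* A function on S(v) is represented by a function on T, whose values outside
   S(v) play no role. *)
Definition zero_sum (v : T) (phi : T -> R[i]) : Prop :=
  \sum_(x \in successors adj w H0 v) phi x = 0.

Definition zero_sum_onb (v : T) (a : 'I_q.-1 -> T -> R[i]) : Prop :=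
  [/\ forall j, zero_sum v (a j),
      forall j k, \sum_(x \in successors adj w H0 v) (a j x * (a k x)^*)
                  = (j == k)%:R
    & forall phi, zero_sum v phi -> exists c : 'I_q.-1 -> R[i],
        forall x, successors adj w H0 v x -> phi x = \sum_j c j * a j x].

(* On the punctured sector of v, h(x) - h(v) is positive, hence equal to its
   absolute value n. *)
Definition gfun (a : T -> 'I_q.-1 -> T -> R[i]) (vj : T * 'I_q.-1) (x : T) :
    R[i] :=
  let n := `|hindex adj w H0 x - hindex adj w H0 vj.1|%N in
  if x \in punctured_sector w vj.1 then
    (\sum_(0 <= i < n) q%:R ^- i)
      * a vj.1 vj.2 (iter n.-1 (predecessor adj w H0) x)
  else 0.

Definition complete_orthogonal_system (alpha : R) (I : Type)
    (e : I -> T -> R[i]) : Prop :=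
  [/\ forall i, bergman alpha (e i),
      forall i, e i <> cst 0,
      forall i j, i <> j -> inner alpha (e i) (e j) = 0
    & forall f, bergman alpha f -> (forall i, inner alpha f (e i) = 0) ->
        f = cst 0].

End Bergman.

(* Main.v *)
Require Import Defs.
From mathcomp Require Import zify ring lra.

(** Orient the tree by sending every vertex x to its neighbour in the direction
    of the boundary point. Iterating this parent map p follows the ray from x,
    two vertices are adjacent exactly when one is the parent of the other
    [adj_parent], the horocyclic index drops by one along p [hindex_parent],
    the successors of v are the solutions of p y = v, and its punctured sector
    consists of the x with p^(n+1) x = v for some n. All later arguments see
    only p, its q-element fibres and the index.

    One identity carries the proof. If f is harmonic, its sum over the n-th
    level below y is [n+1] f(y) - [n] f(p y), with [n] = 1 + q + .. + q^(n-1)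
    [harmonic_level_sum]. On the level n+1 below v, the function g_{v,j} is a
    positive constant times a_{v,j} of the successor of v that lies above the
    point. Summing over a level, the terms [n] f(v) disappear because a_{v,j}
    has zero sum, and there remains a positive multiple of
    z = sum over S(v) of f * conj a_{v,j}. Hence the partial sums of
    <f, g_{v,j}> over the first levels of the sector are K_n z with K_n bounded
    below by a positive constant, and <f, g_{v,j}> = 0 if and only if z = 0
    [inner_gfun_eq0].

    Orthogonality: for v' <> v the function g_{v',j'} is constant on S(v)
    [gfun_siblings], so that z = 0; for v' = v, orthogonality of the a_{v,j}
    applies. Completeness: if f is orthogonal to every g_{v,j}, then on each
    S(v) it is orthogonal to Z_v, hence constant [orthogonal_siblings].
    Harmonicity then computes f(x) from f(p x) and f(p (p x)), so f takes one
    value on all q^n points of the level of x below p^n x [radial_levels]; these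
    points have the same weight and n is arbitrary, so that value must be 0 for
    f to be square summable [bergman_radial_eq0].

    That g_{v,j} lies in the Bergman space is a direct computation: its
    coefficients satisfy the recurrence required by harmonicity [coef_rec] and
    stay below 2, and its norm is dominated by the geometric series of ratio
    q^(1 - alpha) < 1. *)

Import Order.TTheory GRing.Theory Num.Theory.
Import numFieldNormedType.Exports.

Set Implicit Arguments.
Unset Strict Implicit.
Unset Printing Implicit Defensive.

Local Open Scope classical_set_scope.
Local Open Scope ring_scope.

(** * The parent map of a pointed tree and the horocyclic index *)

Section TreeGeometry.
Variables (T : choiceType) (adj : rel T) (q : nat).
Variables (w : set (nat -> T)) (H0 : set T).
Hypotheses (treeT : homogeneous_tree adj q).

(** A shortest return of the walk to a vertex already visited would be a cycle;
    it has at least three vertices because loops are absent and backtracking is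
    excluded. *)
Lemma nonbacktracking_neq (f : nat -> T) (n : nat) :
  (forall i, (i < n)%N -> adj (f i) (f i.+1)) ->
  (forall i, (i.+1 < n)%N -> f i <> f i.+2) ->
  forall i j, (i < j <= n)%N -> f i <> f j.
Proof.
move=> adjf nbf i j; move: {2}(j - i)%N (leqnn (j - i)) => k.
elim: k i j => [|k IHk] i j le_k /andP[lt_ij le_jn] eq_ij; first by lia.
have lt2 : (2 < j - i)%N.
  have ne1 : j <> i.+1.
    by move=> ej; have := adjf i; rewrite -ej -eq_ij;
      rewrite (adj_irreflexive treeT); lia.
  have ne2 : j <> i.+2 by move=> ej; apply: (nbf i); [lia|rewrite -ej].
  lia.
have [d ed] : exists d, (j - i = d.+1)%N by exists (j - i).-1; lia.
have ej : j = (i + d.+1)%N by lia.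
apply: (adj_acyclic treeT (c := mkseq (fun t => f (i + t)%N) d.+1)).
  by rewrite size_mkseq; lia.
apply/andP; split; last first.
  apply/mkseq_uniqP => s t; rewrite !inE => lts ltt eqst.
  case: (ltngtP s t) => // lt_st; exfalso.
  - by apply: (IHk (i + s)%N (i + t)%N) => //; lia.
  - by apply: (IHk (i + t)%N (i + s)%N) => //; lia.
rewrite /mkseq /= addn0.
have -> : f i = f (i + d.+1)%N by rewrite -ej.
have <- : mkseq (fun t => f (i + t.+1)%N) d.+1 =
   rcons [seq f (i + t)%N | t <- iota 1 d] (f (i + d.+1)%N).
  by rewrite mkseqS /mkseq -[1%N]addn0 iotaDl -map_comp.
apply/(pathP (f i)) => s; rewrite size_mkseq => lts.
rewrite nth_mkseq // (addnS i s).
have -> : nth (f i)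
    (f (i + d.+1)%N :: mkseq (fun t => f (i + t.+1)%N) d.+1) s = f (i + s)%N.
  case: s lts => [|s] lts /=; first by rewrite -ej -eq_ij addn0.
  by rewrite nth_mkseq // ltnW.
by apply: adjf; lia.
Qed.

Lemma infinite_chain_inj c : infinite_chain adj c -> injective c.
Proof.
move=> chc; suff lt_neq i j : (i < j)%N -> c i <> c j.
  by move=> i j eqc; case: (ltngtP i j) => // /lt_neq; rewrite eqc.
move=> ltij; apply: (@nonbacktracking_neq c j); last by rewrite ltij leqnn.
- by move=> k _; case: (chc k).
- by move=> k _; case: (chc k).
Qed.

Hypothesis ptw : boundary_point adj w.

(** Trades the integer shift and the threshold for two natural offsets, which
    makes symmetry and transitivity of the relation evident. *)
Lemma chain_equivP (c c' : nat -> T) : chain_equiv c c' <->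
  exists a b, forall i, c (a + i)%N = c' (b + i)%N.
Proof.
split=> [[m [N eqc]]|[a [b eqc]]].
  exists (N + `|m|)%N, (absz ((N + `|m|)%N%:Z + m)%R) => i; apply: eqc; lia.
exists (b%:Z - a%:Z), a => i j leai ej.
have e1 : (a + (i - a))%N = i by lia.
have e2 : (b + (i - a))%N = j by lia.
by rewrite -{1}e1 eqc e2.
Qed.

Lemma end_chain c : w c -> infinite_chain adj c.
Proof. by case: ptw => c0 ? -> []. Qed.

Lemma end_merge c c' : w c -> w c' ->
  exists a b, forall i, c (a + i)%N = c' (b + i)%N.
Proof.
case: ptw => c0 ? -> [_ /chain_equivP[a [b e]]] [_ /chain_equivP[a' [b' e']]].
exists (b + a')%N, (b' + a)%N => i.
by rewrite -addnA -e addnCA e' addnA.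
Qed.

Lemma end_closed c c' : w c -> infinite_chain adj c' ->
  (exists a b, forall i, c (a + i)%N = c' (b + i)%N) -> w c'.
Proof.
case: ptw => c0 ? -> [_ /chain_equivP[a [b e]]] chc' [a' [b' e']].
split=> //; apply/chain_equivP; exists (a + a')%N, (b' + b)%N => i.
by rewrite -addnA e addnCA e' addnA.
Qed.

(** Two rays from the same vertex that part after step k meet again, since they
    share their end. Walking back along the first from the meeting point to the
    vertex of step k and then forward along the second closes up without
    backtracking, against [nonbacktracking_neq]. *)
Lemma end_chain_ext c c' : w c -> w c' -> c 0%N = c' 0%N -> c = c'.
Proof.
move=> wc wc' eq0; apply/funext => n.
have [chc chc'] := (end_chain wc, end_chain wc').
elim: n => // k eqk; apply: contrapT => neqk.
have [a0 [b0 eqab]] := end_merge wc wc'.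
(* The offsets are enlarged so that the meeting point lies beyond step k + 1
   on both rays. *)
pose a := (a0 + k.+2)%N; pose b := (b0 + k.+2)%N.
have {}eqab : c (k + (a - k))%N = c' (k + (b - k))%N.
  by rewrite !subnKC ?eqab // /a /b; lia.
have gta : (1 < a - k)%N by rewrite /a; lia.
have gtb : (1 < b - k)%N by rewrite /b; lia.
move: (a - k)%N (b - k)%N eqab gta gtb => {a b a0 b0} a b eqab gta gtb.
pose g t := if (t <= a)%N then c (k + (a - t))%N else c' (k + (t - a))%N.
have gl t : (t <= a)%N -> g t = c (k + (a - t))%N by rewrite /g => ->.
have gr t : (a <= t)%N -> g t = c' (k + (t - a))%N.
  rewrite leq_eqVlt => /orP[/eqP <-|lt]; last by rewrite /g leqNgt lt.
  by rewrite gl // subnn addn0.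
apply: (@nonbacktracking_neq g (a + b) _ _ 0%N (a + b)%N).
- move=> t ltt; case: (ltnP t a) => ta.
    rewrite !gl ?(ltnW ta) //.
    have -> : (k + (a - t) = (k + (a - t.+1)).+1)%N by lia.
    by rewrite (adj_symmetric treeT); case: (chc (k + (a - t.+1))%N).
  rewrite !gr ?(leqW ta) //.
  have -> : (k + (t.+1 - a) = (k + (t - a)).+1)%N by lia.
  by case: (chc' (k + (t - a))%N).
- move=> t ltt; case: (ltngtP t.+1 a) => ta.
  + rewrite !gl; [|lia|lia].
    have -> : (k + (a - t) = (k + (a - t.+2)).+2)%N by lia.
    by case: (chc (k + (a - t.+2))%N) => _ /nesym.
  + rewrite !gr; [|lia|lia].
    have -> : (k + (t.+2 - a) = (k + (t - a)).+2)%N by lia.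
    by case: (chc' (k + (t - a))%N).
  + rewrite gl ?gr; [|lia|lia].
    have -> : (k + (a - t) = k.+1)%N by lia.
    by have -> : (k + (t.+2 - a) = k.+1)%N by lia.
- by lia.
- by rewrite gl // subn0 eqab gr ?leq_addr // addKn.
Qed.

Lemma infinite_chain_shift c : infinite_chain adj c ->
  infinite_chain adj (fun i => c i.+1).
Proof. by move=> chc i; apply: chc. Qed.

Lemma end_shift c : w c -> w (fun i => c i.+1).
Proof.
move=> wc; apply: (end_closed wc); first exact/infinite_chain_shift/end_chain.
by exists 1%N, 0%N.
Qed.

Definition chain_cons (x : T) (c : nat -> T) (i : nat) : T :=
  if i is j.+1 then c j else x.

Lemma end_cons x c : w c -> adj x (c 0%N) -> x <> c 1%N ->
  w (chain_cons x c).
Proof.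
move=> wc axc xc; apply: (end_closed wc).
  by move=> [|i] /=; [|apply: (end_chain wc)].
by exists 0%N, 1%N.
Qed.

(** Walk from x to the origin of a chain of the class, and move the origin back
    along this walk one edge at a time: an edge that is the first one of the
    chain is removed, any other edge is put in front. *)
Lemma end_start x : exists2 c, w c & c 0%N = x.
Proof.
have [c0 ch0 ew] := ptw.
have w0 : w c0.
  by rewrite ew; split=> //; apply/chain_equivP; exists 0%N, 0%N.
have [s [ps ls]] := adj_connected treeT x (c0 0%N).
elim: s x ps ls => [|y s IHs] x /=; first by move=> _ ->; exists c0.
case/andP=> axy /IHs{}IHs /IHs[c wc cy].
have [xc|xc] := pselect (x = c 1%N).
  by exists (fun i => c i.+1); [exact: end_shift|].
by exists (chain_cons x c) => //; apply: end_cons => //; rewrite cy.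
Qed.

Lemma rayP x : w (ray w x) /\ ray w x 0%N = x.
Proof.
have [c wc cx] := end_start x.
by apply: (xgetPex (fun=> x) (P := [set c | w c /\ c 0%N = x])); exists c.
Qed.

Lemma rayE c : w c -> ray w (c 0%N) = c.
Proof. by move=> wc; have [wr r0] := rayP (c 0%N); apply: end_chain_ext. Qed.

Definition parent (x : T) : T := ray w x 1%N.

Lemma ray_iter x n : ray w x n = iter n parent x.
Proof.
elim: n x => [|n IHn] x; first by case: (rayP x).
by rewrite iterSr -IHn /parent (rayE (end_shift (rayP x).1)).
Qed.

Lemma iter_parent_inj x : injective (fun n => iter n parent x).
Proof.
move=> i j /=; rewrite -!ray_iter.
exact: (infinite_chain_inj (end_chain (rayP x).1)).
Qed.

(** An edge out of x that does not begin the ray of x can be put in front of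
    that ray, giving the ray of its other endpoint. *)
Lemma adj_parent x y : adj x y <-> (parent x = y \/ parent y = x).
Proof.
have apx z : adj z (parent z).
  by have [wr {1}<-] := rayP z; case: (end_chain wr 0%N).
split=> [axy|[<- //|<-]]; last by rewrite (adj_symmetric treeT).
have [|npx] := pselect (parent x = y); [by left|right].
have wc : w (chain_cons y (ray w x)).
  apply: end_cons; [by case: (rayP x)| |by move/esym].
  by rewrite (rayP x).2 (adj_symmetric treeT).
by rewrite /parent -[y]/(chain_cons y (ray w x) 0%N) rayE //= (rayP x).2.
Qed.

Lemma parent_merge x y : exists m n, iter m parent x = iter n parent y.
Proof.
have [a [b e]] := end_merge (rayP x).1 (rayP y).1.
by exists a, b; rewrite -!ray_iter -[a]addn0 e addn0.
Qed.

(** The two differences m - n and m' - n' agree: this is the relative height of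
    x over y, and makes the horocyclic index well defined. *)
Lemma iter_parent_diff x y m n m' n' :
  iter m parent x = iter n parent y -> iter m' parent x = iter n' parent y ->
  (m + n' = m' + n)%N.
Proof.
move=> e e'; apply: (@iter_parent_inj x) => /=.
rewrite addnC iterD e -iterD addnC iterD.
have [a [b f]] := parent_merge x y.
rewrite addnC !iterD e' -!iterD; congr (iter _ _ _); lia.
Qed.

Lemma ray_set_parent x : ray_set w x = [set y | exists n, iter n parent x = y].
Proof.
apply/seteqP; split=> y /=.
  by case=> n _; rewrite ray_iter; exists n.
by case=> n <-; exists n => //; rewrite ray_iter.
Qed.

(** The confluent is the first vertex on the ray of x that also lies on the ray
    of y. *)
Lemma confluentP x y : exists m n,
  [/\ confluent w x y = iter m parent x & confluent w x y = iter n parent y].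
Proof.
have [m0 [n0 e0]] := parent_merge x y.
have exm : exists m, `[< exists n, iter m parent x = iter n parent y >].
  by exists m0; apply/asboolP; exists n0.
case: (ex_minnP exm) => m /asboolP[n e] minm {m0 n0 e0 exm}.
exists m, n; suff -> : confluent w x y = iter m parent x by split.
apply: xget_unique => /= [|z].
  apply/seteqP; split=> z; rewrite !ray_set_parent /=.
    case=> -[i ei] [j ej]; exists (i - m)%N.
    rewrite -iterD subnK //; apply: minm; apply/asboolP.
    by exists j; rewrite ei.
  case=> k <-; split; first by exists (k + m)%N; rewrite iterD.
  by exists (k + n)%N; rewrite e iterD.
move=> ez.
have sub u : (exists i, iter i parent z = u) <->
    (exists i, iter i parent (iter m parent x) = u).
  have := congr1 (fun A => A u) ez; rewrite !ray_set_parent /= => <-.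
  split=> [[[i ei] [j ej]]|[k <-]].
    exists (i - m)%N; rewrite -iterD subnK //; apply: minm; apply/asboolP.
    by exists j; rewrite ei.
  split; first by exists (k + m)%N; rewrite iterD.
  by exists (k + n)%N; rewrite e iterD.
have [i ei] : exists i, iter i parent (iter m parent x) = z.
  by apply/sub; exists 0%N.
have [j ej] : exists i, iter i parent z = iter m parent x.
  by apply/sub; exists 0%N.
have : iter (j + i)%N parent (iter m parent x) =
    iter 0 parent (iter m parent x).
  by rewrite iterD ei ej.
move/iter_parent_inj => ij0; have i0 : i = 0%N by lia.
by move: ei; rewrite i0.
Qed.

(** Every step of a walk changes by one the number of parent moves on one side,
    so a walk cannot be shorter than the detour through a common ancestor. This
    is the lower bound behind [dist_iter_parent]. *)
Lemma walk_parent x y s : joins adj x y s ->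
  exists a b, (a + b <= size s)%N /\ iter a parent x = iter b parent y.
Proof.
elim/last_ind: s y => [|s z IHs] y [] /=; first by move=> _ <-; exists 0%N, 0%N.
rewrite rcons_path last_rcons size_rcons => /andP[ps /adj_parent azy] <-.
have [a [b [le_ab eab]]] := IHs _ (conj ps erefl).
case: azy => [ez|ez]; last first.
  by exists a, b.+1; split; [lia|rewrite eab iterSr ez].
case: b le_ab eab => [|b] le_ab eab.
  by exists a.+1, 0%N; split; [lia|rewrite iterS eab].
by exists a, b; split; [lia|rewrite eab iterSr ez].
Qed.

Lemma dist_iter_parent x n : dist adj x (iter n parent x) = n.
Proof.
have walkn : walk_length adj x (iter n parent x) n.
  exists (traject parent (parent x) n); last by rewrite size_traject.
  split; last by elim: n x => //= n IHn x; rewrite IHn -iterS iterSr.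
  elim: n x => //= n IHn x; rewrite IHn andbT; apply/adj_parent; by left.
have minn m : walk_length adj x (iter n parent x) m -> (n <= m)%N.
  case=> s js <-; have [a [b [le_ab]]] := walk_parent js.
  by rewrite -iterD => /iter_parent_inj; lia.
apply: xget_unique => //= m [wm /(_ n walkn) le_mn].
by apply/eqP; rewrite eqn_leq le_mn minn.
Qed.

(** The relative height of x over y can be read off at any common ancestor, not
    only at the confluent. *)
Lemma confluent_dist x y m n : iter m parent x = iter n parent y ->
  (dist adj x (confluent w x y) + n = m + dist adj y (confluent w x y))%N.
Proof.
have [a [b [ea eb]]] := confluentP x y => e.
rewrite {1}ea eb !dist_iter_parent.
by apply: (@iter_parent_diff x y) => //; rewrite -ea eb.
Qed.

Hypothesis horoH0 : horocycle adj w H0.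

(** A vertex x0 of the reference horocycle turns the index into a relative
    height over x0, measured at an arbitrary common ancestor. *)
Lemma horo_parent : exists x0, forall k x, horo adj w H0 k x <->
  exists m n, iter m parent x = iter n parent x0 /\ m%:Z = n%:Z + k.
Proof.
have [x0 eH0] := horoH0; exists x0 => k x; rewrite /horo /= eH0 /=.
split=> [[y sameH ek]|[m [n [e ek]]]].
  have [l [l' el]] := parent_merge x0 y.
  have [m [n e]] := parent_merge x y.
  have := confluent_dist e; move: sameH (confluent_dist el).
  rewrite /same_horocycle => <- {}sameH dxy.
  have ell : l = l' by lia.
  exists (l' + m)%N, (n + l)%N; split; last lia.
  by rewrite !iterD e el -!iterD addnC.
exists x0; last by have := confluent_dist e; lia.
by have := confluent_dist (erefl : iter 0 parent x0 = iter 0 parent x0);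
  rewrite /same_horocycle; lia.
Qed.

Lemma hindex_horo x k : horo adj w H0 k x <-> hindex adj w H0 x = k.
Proof.
have [x0 hor] := horo_parent.
have uniq l l' : horo adj w H0 l x -> horo adj w H0 l' x -> l = l'.
  move=> /hor[m [n [e el]]] /hor[m' [n' [e' el']]].
  have := iter_parent_diff e e'; lia.
have ex : exists k, horo adj w H0 k x.
  have [m [n e]] := parent_merge x x0; exists (m%:Z - n%:Z).
  by apply/hor; exists m, n; split=> //; lia.
have hx := xgetPex 0 (P := [set k | horo adj w H0 k x]) ex.
by split=> [|<- //]; apply: uniq.
Qed.

Lemma hindex_parent x : hindex adj w H0 (parent x) = hindex adj w H0 x - 1.
Proof.
have [x0 hor] := horo_parent; apply/hindex_horo/hor.
have /hor[m [n [e ek]]] := (hindex_horo x _).2 erefl.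
exists m, n.+1; split; last by lia.
by rewrite -iterSr !iterS e.
Qed.

Lemma predecessorE x : predecessor adj w H0 x = parent x.
Proof.
apply: xget_unique => /= [|y [/adj_parent[//|ey] /hindex_horo hy]].
  by split; [apply/adj_parent; left|apply/hindex_horo/hindex_parent].
by have := hindex_parent y; rewrite ey hy; lia.
Qed.

Lemma successorsE v : successors adj w H0 v = [set y | parent y = v].
Proof.
apply/seteqP; split=> y /=; rewrite /successors /= predecessorE.
  by case=> /adj_parent[->|].
move=> ey; split; first by apply/adj_parent; right.
by move=> ey'; have := hindex_parent v; rewrite -ey' -ey hindex_parent; lia.
Qed.

Lemma sectorE v : sector w v = [set y | exists n, iter n parent y = v].
Proof.
apply/seteqP; split=> y /=; rewrite /sector /= !ray_set_parent.
  by move/(_ v) => /=; apply; exists 0%N.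
by case=> n <- z [m <-]; exists (m + n)%N; rewrite iterD.
Qed.

Lemma punctured_sectorE v :
  punctured_sector w v = [set y | exists n, iter n.+1 parent y = v].
Proof.
rewrite /punctured_sector sectorE; apply/seteqP; split=> y /=.
  by case=> -[[|n] ey] ny; [rewrite -ey in ny|exists n].
case=> n ey; split; first by exists n.+1.
move=> eyv; suff : n.+1 = 0%N by [].
by apply: (@iter_parent_inj y); rewrite /= ey eyv.
Qed.

(** Listing the finitely many neighbours and children of a vertex lets sums over
    them be handled as sums over duplicate-free sequences. *)
Definition neighbours (v : T) : seq T :=
  finmap.enum_fset (fset_set [set y | adj v y]).
Definition children (v : T) : seq T := [seq y <- neighbours v | parent y == v].

Lemma mem_neighbours v y : (y \in neighbours v) = adj v y.
Proof.
rewrite in_fset_set; last first.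
  by apply/finite_setP; exists q.+1; apply: (adj_degree treeT).
by apply/idP/idP; rewrite inE.
Qed.

Lemma neighbours_uniq v : uniq (neighbours v).
Proof. exact: finmap.fset_uniq. Qed.

Lemma children_uniq v : uniq (children v).
Proof. exact/filter_uniq/neighbours_uniq. Qed.

Lemma mem_children v y : (y \in children v) = (parent y == v).
Proof.
rewrite mem_filter mem_neighbours; case: eqP => //= ey.
by apply/adj_parent; right.
Qed.

Lemma neighbours_perm v : perm_eq (neighbours v) (parent v :: children v).
Proof.
apply: uniq_perm; first exact: neighbours_uniq.
  rewrite /= children_uniq mem_children andbT; apply/negP => /eqP e.
  by have := @iter_parent_inj v 2 0 e.
move=> y; rewrite mem_neighbours inE mem_children; apply/idP/orP.
  by move/adj_parent => [<-|->]; [left|right].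
by move=> h; apply/adj_parent; case: h => /eqP; [left|right].
Qed.

Lemma size_children v : size (children v) = q.
Proof.
have := perm_size (neighbours_perm v).
by rewrite /= (card_fset_set (adj_degree treeT v)) => -[].
Qed.

End TreeGeometry.

(** * Sums of summable families as limits over exhaustions *)

Section Exhaustion.
Variables (R : realType) (T : choiceType).

(** The sum of a summable family supported in S is the limit of its sums over
    the pieces B n, see [real_sum_cvg]. *)
Definition exhausts (S : set T) (B : nat -> seq T) : Prop :=
  [/\ forall n, uniq (B n), forall n m, (n <= m)%N -> {subset B n <= B m}
    & forall x, S x -> exists n, x \in B n].

Lemma ler_sum_subset (G : T -> R) (s t : seq T) : (forall x, 0 <= G x) ->
  uniq s -> uniq t -> (forall x, x \in s -> G x != 0 -> x \in t) ->
  \sum_(x <- s) G x <= \sum_(x <- t) G x.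
Proof.
move=> G0 us ut sub.
rewrite (bigID (mem t) (r := s)) /= [X in _ + X]big1_seq ?addr0; last first.
  move=> x /andP[nxt xs]; apply/eqP; apply: contraNT nxt; exact: sub.
rewrite -big_filter (perm_big [seq x <- t | x \in s]); last first.
  apply: uniq_perm; rewrite ?filter_uniq // => x.
  by rewrite !mem_filter andbC.
by rewrite big_filter [leRHS](bigID (mem s)) /= lerDl sumr_ge0.
Qed.

Lemma ler_sum_esum (G : T -> R) (s : seq T) : uniq s ->
  ((\sum_(x <- s) G x)%:E <= \esum_(x in [set: T]) (G x)%:E)%E.
Proof.
move=> us; apply: esum_ge; exists [set` s]; first by split.
by rewrite -fsbig_seq // sumEFin.
Qed.

Lemma esum_exhaustion (G : T -> R) (B : nat -> seq T) :
  (forall x, 0 <= G x) -> exhausts [set x | G x != 0] B ->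
  \esum_(x in [set: T]) (G x)%:E =
  ereal_sup (range (fun n => (\sum_(x <- B n) G x)%:E)).
Proof.
move=> G0 [uB mB sB]; apply/eqP; rewrite eq_le; apply/andP; split; last first.
  by apply: ge_ereal_sup => _ [n _ <-]; apply: ler_sum_esum.
apply: ge_ereal_sup => _ [A [finA _] <-].
rewrite fsbig_finite // sumEFin.
set s := finmap.enum_fset _.
have [N subN] : exists N, forall x, x \in s -> G x != 0 -> x \in B N.
  elim: s => [|y s [N sub]]; first by exists 0%N.
  have [Gy|Gy] := eqVneq (G y) 0.
    by exists N => x; rewrite inE => /orP[/eqP ->|/sub //]; rewrite Gy eqxx.
  have [M yM] := sB y Gy; exists (maxn N M) => x.
  rewrite inE => /orP[/eqP ->|xs] Gx; first by apply: mB yM; rewrite leq_maxr.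
  by apply: mB (sub _ xs Gx); rewrite leq_maxl.
apply: le_ereal_sup_tmp; exists (\sum_(x <- B N) G x)%:E; first by exists N.
by rewrite lee_fin ler_sum_subset // finmap.fset_uniq.
Qed.

Lemma sum_exhaustion_cvg (G : T -> R) (B : nat -> seq T) :
  (forall x, 0 <= G x) -> exhausts [set x | G x != 0] B ->
  (\esum_(x in [set: T]) (G x)%:E < +oo)%E ->
  (fun n => \sum_(x <- B n) G x) @ \oo -->
    fine (\esum_(x in [set: T]) (G x)%:E).
Proof.
move=> G0 exB fin; have [uB mB _] := exB.
have cvgE : (fun n => (\sum_(x <- B n) G x)%:E) @ \oo -->
    \esum_(x in [set: T]) (G x)%:E.
  rewrite (esum_exhaustion G0 exB); apply: ereal_nondecreasing_cvgn => n m nm.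
  by rewrite lee_fin ler_sum_subset // => x xn _; apply: mB xn.
have sum0 : (0 <= \esum_(x in [set: T]) (G x)%:E)%E.
  by apply: esum_ge0 => x _; rewrite lee_fin.
apply: (@fine_cvg R nat \oo _ (fun n => (\sum_(x <- B n) G x)%:E)).
by rewrite fineK // ge0_fin_numE.
Qed.

Lemma real_sum_cvg (F : T -> R) (B : nat -> seq T) :
  exhausts [set x | F x != 0] B ->
  (\esum_(x in [set: T]) `|F x|%:E < +oo)%E ->
  (fun n => \sum_(x <- B n) F x) @ \oo --> real_sum F.
Proof.
move=> [uB mB sB] fin; rewrite /real_sum.
have posE : (EFin \o F)^\+%E = fun x => (Num.max (F x) 0)%:E.
  by apply/funext => x; rewrite numfun.funeposE /= EFin_max.
have negE : (EFin \o F)^\-%E = fun x => (Num.max (- F x) 0)%:E.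
  by apply/funext => x; rewrite numfun.funenegE /= EFin_max.
rewrite posE negE.
have bnd (G : T -> R) : (forall x, 0 <= G x) -> (forall x, G x <= `|F x|) ->
    (fun n => \sum_(x <- B n) G x) @ \oo -->
      fine (\esum_(x in [set: T]) (G x)%:E).
  move=> G0 GF; apply: sum_exhaustion_cvg => //.
    split=> // x /= Gx; apply: sB => /=; apply: contra Gx => /eqP Fx.
    by rewrite eq_le G0 (le_trans (GF x)) // Fx normr0.
  by apply: le_lt_trans fin; apply: le_esum => x _; rewrite lee_fin.
have -> : (fun n => \sum_(x <- B n) F x) =
    (fun n => \sum_(x <- B n) Num.max (F x) 0) -
    (fun n => \sum_(x <- B n) Num.max (- F x) 0).
  apply/funext => n; rewrite !fctE -sumrB; apply: eq_bigr => x _.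
  by case: (lerP (F x) 0) => h; case: (lerP (- F x) 0) => h'; lra.
apply: cvgB; apply: bnd => x; rewrite ?le_max ?lexx ?orbT //.
  by rewrite ge_max normr_ge0 ler_norm.
by rewrite ge_max normr_ge0 -normrN ler_norm.
Qed.

Lemma normc_Re (z : R[i]) : `|complex.Re z| <= Normc.normc z.
Proof.
case: z => a b /=; rewrite -sqrtr_sqr ler_wsqrtr // lerDl sqr_ge0 //.
Qed.

Lemma normc_Im (z : R[i]) : `|complex.Im z| <= Normc.normc z.
Proof.
case: z => a b /=; rewrite -sqrtr_sqr ler_wsqrtr // lerDr sqr_ge0 //.
Qed.

Lemma Re_sum (F : T -> R[i]) s :
  complex.Re (\sum_(x <- s) F x) = \sum_(x <- s) complex.Re (F x).
Proof. by apply: (big_morph _ (id1 := 0)) => // -[a b] [c d]. Qed.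

Lemma Im_sum (F : T -> R[i]) s :
  complex.Im (\sum_(x <- s) F x) = \sum_(x <- s) complex.Im (F x).
Proof. by apply: (big_morph _ (id1 := 0)) => // -[a b] [c d]. Qed.

(** Only the vanishing of a sum matters for orthogonality, so the factors K need
    not converge: staying away from 0 is enough. The real and the imaginary part
    are treated alike, through an abstract real-linear P bounded by the
    modulus. *)
Lemma complex_sum_eq0 (F : T -> R[i]) (B : nat -> seq T) (K : nat -> R)
    (k : R) (z : R[i]) :
  exhausts [set x | F x != 0] B ->
  (\esum_(x in [set: T]) (Normc.normc (F x))%:E < +oo)%E ->
  (forall n, \sum_(x <- B n) F x = (K n)%:C%C * z) ->
  0 < k -> (forall n, (0 < n)%N -> k <= K n) ->
  complex_sum F = 0 <-> z = 0.
Proof.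
move=> [uB mB sB] fin eqK k0 leK.
have key (P : R[i] -> R) :
    (forall s, P (\sum_(x <- s) F x) = \sum_(x <- s) P (F x)) ->
    (forall (r : R) (u : R[i]), P (r%:C%C * u) = r * P u) ->
    (forall u, `|P u| <= Normc.normc u) ->
    real_sum (fun x => P (F x)) = 0 <-> P z = 0.
  move=> Psum PZ Pn.
  have : (fun n => \sum_(x <- B n) P (F x)) @ \oo -->
      real_sum (fun x => P (F x)).
    apply: real_sum_cvg.
      split=> // x /= PF; apply: sB => /=; apply: contra PF => /eqP ->.
      by rewrite -normr_le0 (le_trans (Pn _)) // Normc.normc0.
    by apply: le_lt_trans fin; apply: le_esum => x _; rewrite lee_fin.
  have -> : (fun n => \sum_(x <- B n) P (F x)) = (fun n => K n * P z).
    by apply/funext => n; rewrite -Psum eqK PZ.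
  move=> cvgK; split=> [s0|Pz0]; last first.
    have K0 : (fun n => K n * P z) = cst 0.
      by apply/funext => n; rewrite Pz0 mulr0.
    rewrite K0 in cvgK; apply: (cvg_unique _ cvgK) => //; exact: cvg_cst.
  rewrite s0 in cvgK; apply/eqP; rewrite -normr_le0 -(pmulr_rle0 _ k0).
  have cvgN : `|K n * P z| @[n --> \oo] --> (0 : R).
    by rewrite -(@normr0 _ R); apply: cvg_norm.
  apply: (cvgr_to_ge cvgN); exists 1%N => // n /= n0.
  by rewrite normrM ler_wpM2r // ler_normr leK.
have ReZ (r : R) (u : R[i]) : complex.Re (r%:C%C * u) = r * complex.Re u.
  by case: u => s t /=; rewrite mul0r subr0.
have ImZ (r : R) (u : R[i]) : complex.Im (r%:C%C * u) = r * complex.Im u.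
  by case: u => s t /=; rewrite mul0r addr0.
have kRe := key _ (Re_sum F) ReZ normc_Re.
have kIm := key _ (Im_sum F) ImZ normc_Im.
rewrite /complex_sum; split.
  by case=> /kRe Rz /kIm Iz; case: z Rz Iz {kRe kIm key eqK} => a b /= -> ->.
move=> z0; move: kRe kIm; rewrite z0 /= => -[_ /(_ erefl) ->] [_ /(_ erefl) ->].
by [].
Qed.
End Exhaustion.

(** * Descendants and level sums of harmonic functions *)

Section Descendants.
Variables (T : choiceType) (p : T -> T) (ch : T -> seq T) (q : nat).
Hypothesis ch_uniq : forall v, uniq (ch v).
Hypothesis mem_ch : forall v y, (y \in ch v) = (p y == v).
Hypothesis size_ch : forall v, size (ch v) = q.

Fixpoint descendants (n : nat) (y : T) : seq T :=
  if n is m.+1 then flatten [seq descendants m z | z <- ch y] else [:: y].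

Lemma mem_descendants n y x : (x \in descendants n y) = (iter n p x == y).
Proof.
elim: n y => [|n IHn] y /=; first by rewrite inE.
apply/flatten_mapP/eqP => [[z]|ey].
  by rewrite mem_ch IHn => /eqP <- /eqP ->.
by exists (iter n p x); rewrite ?mem_ch ?IHn ?ey.
Qed.

Lemma flatten_map_uniq (I U : eqType) (F : I -> seq U) (s : seq I) : uniq s ->
  (forall i, uniq (F i)) ->
  (forall i j x, x \in F i -> x \in F j -> i = j) ->
  uniq (flatten [seq F i | i <- s]).
Proof.
move=> us uF disF; elim: s us => //= i s IHs /andP[nis us].
rewrite cat_uniq uF IHs // andbT /=; apply/hasPn => x /flatten_mapP[j js xj].
by apply: contra nis => xi; rewrite (disF _ _ _ xi xj).
Qed.

Lemma descendants_uniq n y : uniq (descendants n y).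
Proof.
elim: n y => //= n IHn y; apply: flatten_map_uniq => // z z' x.
by rewrite !mem_descendants => /eqP <- /eqP.
Qed.

Lemma size_descendants n y : size (descendants n y) = (q ^ n)%N.
Proof.
elim: n y => //= n IHn y; rewrite size_flatten /shape -map_comp.
rewrite sumnE big_map; under eq_bigr do rewrite /= IHn.
by rewrite big_const_seq count_predT size_ch iter_addn_0 expnS mulnC.
Qed.

Lemma sum_descendantsS (K : nmodType) (F : T -> K) n y :
  \sum_(x <- descendants n.+1 y) F x =
  \sum_(z <- ch y) \sum_(x <- descendants n z) F x.
Proof. by rewrite /= big_flatten big_map. Qed.

Definition geometric_sum (n : nat) : nat := \sum_(0 <= i < n) q ^ i.

Lemma geometric_sumS n : geometric_sum n.+1 = (1 + q * geometric_sum n)%N.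
Proof.
rewrite /geometric_sum big_nat_recl //= expn0 big_distrr /=; congr (_ + _)%N.
by apply: eq_bigr => i _; rewrite expnS.
Qed.

(** Grouping a level by the children z of y, induction gives
    [n+1] * (sum of f(z)) - q [n] f(y), and harmonicity at y replaces the sum
    over the children by (q + 1) f(y) - f(p y). *)
Lemma harmonic_level_sum (K : comPzRingType) (f : T -> K) :
  (forall x, q.+1%:R * f x = f (p x) + \sum_(y <- ch x) f y) ->
  forall n y, \sum_(x <- descendants n y) f x =
    (geometric_sum n.+1)%:R * f y - (geometric_sum n)%:R * f (p y).
Proof.
move=> harm; elim=> [|n IHn] y.
  rewrite /= big_seq1 /geometric_sum big_nat1 big_geq // expn0.
  by rewrite mulr1n mulr0n mul1r mul0r subr0.
rewrite sum_descendantsS.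
under eq_bigr do rewrite IHn.
rewrite sumrB -mulr_sumr -[X in _ * X - _](addKr (f (p y))) -harm.
have -> : \sum_(z <- ch y) (geometric_sum n)%:R * f (p z) =
    q%:R * ((geometric_sum n)%:R * f y).
  rewrite (eq_big_seq (fun=> (geometric_sum n)%:R * f y)); last first.
    by move=> z; rewrite mem_ch => /eqP ->.
  by rewrite big_const_seq count_predT size_ch iter_addr_0 [RHS]mulr_natl.
rewrite (geometric_sumS n.+1) (geometric_sumS n) -natr1 !(natrD, natrM); ring.
Qed.

Hypothesis iter_inj : forall x, injective (fun n => iter n p x).

(** The first n levels strictly below v: finite pieces exhausting the punctured
    sector of v, which carries g_{v,j}. *)
Definition levels (v : T) (n : nat) : seq T :=
  flatten [seq descendants i.+1 v | i <- index_iota 0 n].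

Lemma mem_levels v n x :
  (x \in levels v n) <-> exists2 i, (i < n)%N & iter i.+1 p x = v.
Proof.
split=> [xl|[i lin ei]].
  have [i lin] := @flatten_mapP _ _ _ _ _ xl; rewrite mem_descendants => /eqP.
  by exists i => //; rewrite mem_index_iota in lin.
apply/flatten_mapP; exists i; first by rewrite mem_index_iota.
by rewrite mem_descendants; apply/eqP.
Qed.

Lemma levels_uniq v n : uniq (levels v n).
Proof.
apply: flatten_map_uniq => [|i|i j x]; first exact: iota_uniq.
  exact: descendants_uniq.
by rewrite !mem_descendants => /eqP <- /eqP /iter_inj [].
Qed.

Lemma levels_exhausts v (S : set T) :
  (forall x, S x -> exists n, iter n.+1 p x = v) -> exhausts S (levels v).
Proof.
move=> subS; split=> [n|n m le_nm x|x /subS[n e]]; first exact: levels_uniq.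
  move/mem_levels => [i lin e]; apply/mem_levels; exists i => //.
  exact: leq_trans le_nm.
by exists n.+1; apply/mem_levels; exists n.
Qed.

Lemma sum_levels (K : nmodType) (F : T -> K) v n :
  \sum_(x <- levels v n) F x =
  \sum_(0 <= i < n) \sum_(y <- ch v) \sum_(x <- descendants i y) F x.
Proof.
rewrite /levels big_flatten big_map; apply: eq_bigr => i _.
exact: sum_descendantsS.
Qed.

End Descendants.

(** * The functions g and the Bergman space *)

Section Bergman.
Variables (R : realType) (q : nat) (T : choiceType) (adj : rel T).
Variables (w : set (nat -> T)) (H0 : set T) (alpha : R).
Variables (a : T -> 'I_q.-1 -> T -> R[i]).
Hypothesis treeT : homogeneous_tree adj q.
Hypotheses (ptw : boundary_point adj w) (horoH0 : horocycle adj w H0).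

Let p := parent w.
Let ch := children adj w.
Let W := weight adj q w H0 alpha.
Let g := gfun adj w H0 a.
Let ch_uniq := children_uniq adj w.
Let mem_ch v y : (y \in ch v) = (p y == v) := mem_children treeT ptw v y.
Let size_ch := size_children treeT ptw.
Let iter_inj x : injective (fun n => iter n p x) :=
  @iter_parent_inj _ _ _ _ treeT ptw x.

Let predE : predecessor adj w H0 = p :=
  funext (predecessorE treeT ptw horoH0).

Lemma sum_successors (F : T -> R[i]) v :
  \sum_(x \in successors adj w H0 v) F x = \sum_(x <- ch v) F x.
Proof.
rewrite (successorsE treeT ptw horoH0) [RHS]fsbig_seq //.
congr (\sum_(x \in _) F x); apply/seteqP; split=> y /=.
  by move=> e; rewrite mem_ch; apply/eqP.
by rewrite mem_ch => /eqP.
Qed.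

Lemma harmonicP (f : T -> R[i]) : harmonic adj q f <->
  forall x, q.+1%:R * f x = f (p x) + \sum_(y <- ch x) f y.
Proof.
have E x : \sum_(y \in [set y | adj x y]) f y = f (p x) + \sum_(y <- ch x) f y.
  transitivity (\sum_(y <- p x :: ch x) f y); last by rewrite big_cons.
  rewrite -(perm_big _ (neighbours_perm treeT ptw x)) /=.
  rewrite [RHS]fsbig_seq; last exact: neighbours_uniq.
  congr (\sum_(y \in _) f y); apply/seteqP; split=> y /=.
    by rewrite (mem_neighbours treeT).
  by rewrite (mem_neighbours treeT).
have n0 : (q.+1)%:R != 0 :> R[i] by rewrite pnatr_eq0.
split=> hf x; first by rewrite {1}hf E mulVKf.
by apply: (mulfI n0); rewrite hf E mulVKf.
Qed.

Definition coef (n : nat) : R := \sum_(0 <= i < n) q%:R ^- i.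

Lemma coefE n : \sum_(0 <= i < n) (q%:R : R[i]) ^- i = (coef n)%:C%C.
Proof.
rewrite /coef rmorph_sum; apply: eq_bigr => i _.
by rewrite fmorphV rmorphXn /= rmorph_nat.
Qed.

Lemma coef0 : coef 0 = 0. Proof. by rewrite /coef big_geq. Qed.

Lemma coefS n : coef n.+1 = 1 + q%:R^-1 * coef n.
Proof.
rewrite /coef big_nat_recl //= expr0 invr1 mulr_sumr; congr (_ + _).
by apply: eq_bigr => i _; rewrite exprS invfM.
Qed.

Lemma coef1 : coef 1 = 1. Proof. by rewrite coefS coef0 mulr0 addr0. Qed.

Lemma coef_ge0 n : 0 <= coef n.
Proof. by apply: sumr_ge0 => i _; rewrite invr_ge0 exprn_ge0 // ler0n. Qed.

Lemma gfun_desc v j x n : iter n.+1 p x = v ->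
  g (v, j) x = (coef n.+1)%:C%C * a v j (iter n p x).
Proof.
move=> ev; rewrite /g /gfun /= ifT; last first.
  by rewrite (punctured_sectorE treeT ptw); apply/mem_set; exists n.
have -> : absz (hindex adj w H0 x - hindex adj w H0 v) = n.+1.
  have hi k : hindex adj w H0 (iter k p x) = hindex adj w H0 x - k%:Z.
    elim: k => [|k IHk]; first by rewrite subr0.
    by rewrite iterS (hindex_parent treeT ptw horoH0) IHk; lia.
  by rewrite -ev hi; lia.
by rewrite coefE predE.
Qed.

Lemma gfun_out v j x : (forall n, iter n.+1 p x <> v) -> g (v, j) x = 0.
Proof.
move=> nv; rewrite /g /gfun /= ifF //; apply/negP.
by rewrite (punctured_sectorE treeT ptw) => /set_mem[n] /nv.
Qed.

Lemma gfun_child v j y : y \in ch v -> g (v, j) y = a v j y.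
Proof.
by rewrite mem_ch => /eqP e; rewrite (@gfun_desc v j y 0) // coef1 mul1r.
Qed.

(** The values of g_{v',j} on two successors of v can differ only if these are
    the successors of v' itself; further down they come from the same value of
    a_{v',j}. *)
Lemma gfun_siblings v v' j : v' <> v ->
  exists t, forall y, y \in ch v -> g (v', j) y = t.
Proof.
move=> nv; have [[n e]|nx] := pselect (exists n, iter n.+1 p v = v').
  exists ((coef n.+2)%:C%C * a v' j (iter n p v)) => y.
  rewrite mem_ch => /eqP ey.
  by rewrite (@gfun_desc v' j y n.+1) iterSr ey.
exists 0 => y; rewrite mem_ch => /eqP ey; apply: gfun_out => -[|n].
  by rewrite /= ey => /esym.
by rewrite iterSr ey => e; apply: nx; exists n.
Qed.

Hypothesis hq : (2 <= q)%N.

Lemma q_gt0 : 0 < q%:R :> R.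
Proof. by rewrite ltr0n ltnW. Qed.

Lemma q_neq0 : q%:R != 0 :> R[i].
Proof. by rewrite pnatr_eq0 -lt0n ltnW. Qed.

Lemma coef_le2 n : coef n <= 2.
Proof.
elim: n => [|n IHn]; first by rewrite coef0.
have q2 : 2 <= q%:R :> R by rewrite (ler_nat _ 2).
rewrite coefS; have : q%:R^-1 * coef n <= 2^-1 * 2.
  apply: ler_pM => //; rewrite ?invr_ge0 ?ler0n ?coef_ge0 //.
  by rewrite lef_pV2 // posrE ?q_gt0.
by rewrite mulVf // -(lerD2l 1).
Qed.

(** The harmonicity of g_{v,j} inside the sector of v, where it depends on the
    depth through [coef] alone. *)
Lemma coef_rec n : q.+1%:R * coef n.+1 = coef n + q%:R * coef n.+2.
Proof.
have q0 := gt_eqF q_gt0.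
elim: n => [|n IHn].
  by rewrite !coefS coef0 -natr1; field; rewrite q0.
rewrite [in RHS](coefS n.+2) [X in X + _](coefS n) [in LHS]coefS !mulrDr.
rewrite mulrCA IHn -natr1; by field; rewrite q0.
Qed.

Hypothesis onb : forall v : T, zero_sum_onb adj w H0 v (a v).

Lemma sum_onb0 v j : \sum_(x <- ch v) a v j x = 0.
Proof. by case: (onb v) => z _ _; rewrite -sum_successors; apply: z. Qed.

Lemma sum_onb v j k : \sum_(x <- ch v) a v j x * (a v k x)^* = (j == k)%:R.
Proof. by case: (onb v) => _ o _; rewrite -sum_successors; apply: o. Qed.

(** Inside the punctured sector this is [coef_rec], with coefficient 0 at v
    itself; at v it is the zero sum of a_{v,j}; elsewhere all values involved
    vanish. *)
Lemma gfun_harmonic v j : harmonic adj q (g (v, j)).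
Proof.
apply/harmonicP => x.
have [[n ex]|nx] := pselect (exists n, iter n.+1 p x = v).
  rewrite (gfun_desc j ex).
  rewrite (eq_big_seq (fun=> (coef n.+2)%:C%C * a v j (iter n p x))).
    rewrite big_const_seq count_predT size_ch iter_addr_0.
    have -> : g (v, j) (p x) = (coef n)%:C%C * a v j (iter n p x).
      case: n ex => [|n] ex.
        rewrite coef0 mul0r gfun_out // => n; rewrite -ex => e.
        by have := @iter_inj (p x) n.+1 0%N e.
      by rewrite (@gfun_desc v j (p x) n) -?iterSr.
    rewrite -[_ *+ q]mulr_natl !mulrA -mulrDl; congr (_ * _).
    rewrite -[q.+1%:R](rmorph_nat (real_complex R)).
    rewrite -[q%:R](rmorph_nat (real_complex R)).
    by rewrite -!rmorphM -rmorphD /= coef_rec.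
  move=> y; rewrite mem_ch => /eqP ey.
  by rewrite (@gfun_desc v j y n.+1) iterSr ey.
have px n : iter n.+1 p (p x) <> v.
  by move=> e; apply: nx; exists n.+1; rewrite iterSr.
have gx : g (v, j) x = 0 by apply: gfun_out => n e; apply: nx; exists n.
rewrite gx (gfun_out j px) mulr0 add0r.
have [<-|xv] := pselect (v = x).
  by rewrite (eq_big_seq (a v j)) ?sum_onb0 // => y; apply: gfun_child.
rewrite big1_seq // => y /= ; rewrite mem_ch => /eqP ey.
apply: gfun_out => -[|n]; first by rewrite /= ey => /esym.
by rewrite iterSr ey => e; apply: nx; exists n.
Qed.

Lemma gfun_neq0 vj : g vj <> cst 0.
Proof.
case: vj => v j g0; have := sum_onb v j j.
rewrite eqxx big1_seq => [/esym/eqP|y /= yv].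
  by rewrite oner_eq0.
by rewrite -(gfun_child _ yv) g0 mul0r.
Qed.

(** Subtracting the mean m of f over S(v) gives an element phi of Z_v that is
    orthogonal to the basis of Z_v, hence zero. *)
Lemma orthogonal_siblings (f : T -> R[i]) v :
  (forall j, \sum_(y <- ch v) f y * (a v j y)^* = 0) ->
  forall y y', p y = v -> p y' = v -> f y = f y'.
Proof.
move=> ort; have [_ _ span] := onb v.
pose m := q%:R^-1 * \sum_(y <- ch v) f y.
pose phi x := f x - m.
have [c ec] : exists c : 'I_q.-1 -> R[i], forall x, successors adj w H0 v x ->
    phi x = \sum_j c j * a v j x.
  apply: span; rewrite /zero_sum sum_successors sumrB big_const_seq count_predT.
  by rewrite size_ch iter_addr_0 -mulr_natl mulVKf ?q_neq0 // subrr.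
have {}ec x : x \in ch v -> phi x = \sum_j c j * a v j x.
  rewrite mem_ch => /eqP ex; apply: ec.
  by rewrite (successorsE treeT ptw horoH0).
have phi0 y : y \in ch v -> phi y = 0.
  have : \sum_(y <- ch v) `|phi y| ^+ 2 = 0.
    under eq_bigr do rewrite normCK.
    rewrite (eq_big_seq (fun y => \sum_j (c j)^* * (phi y * (a v j y)^*))).
      rewrite exchange_big big1 // => j _; rewrite -mulr_sumr.
      under eq_bigr do rewrite mulrBl.
      rewrite sumrB ort -mulr_sumr -raddf_sum sum_onb0 raddf0.
      by rewrite mulr0 subrr mulr0.
    move=> x xv; rewrite {2}(ec x xv) rmorph_sum mulr_sumr.
    apply: eq_bigr => j _.
    by rewrite /= rmorphM; ring.
  move/eqP; rewrite psumr_eq0 => [/allP al /al|i _]; last by rewrite exprn_ge0.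
  by rewrite expf_eq0 /= normr_eq0 => /eqP.
move=> y y' /eqP; rewrite -mem_ch => /phi0 /subr0_eq -> /eqP.
by rewrite -mem_ch => /phi0 /subr0_eq ->.
Qed.

(** If f agrees on siblings, harmonicity at p x reads
    q f(x) = (q + 1) f(p x) - f(p (p x)), so the values propagate down from a
    common ancestor. *)
Lemma radial_levels (f : T -> R[i]) : harmonic adj q f ->
  (forall y y', p y = p y' -> f y = f y') ->
  forall n x x', iter n p x = iter n p x' -> f x = f x'.
Proof.
move=> /harmonicP harm sib.
have step x : q%:R * f x = q.+1%:R * f (p x) - f (p (p x)).
  rewrite harm addrAC subrr add0r (eq_big_seq (fun=> f x)).
    by rewrite big_const_seq count_predT size_ch iter_addr_0 mulr_natl.
  by move=> y; rewrite mem_ch => /eqP; apply: sib.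
elim/ltn_ind => -[|[|n]] IHn x x'; [by move=> /= ->|exact: sib|move=> e].
apply: (mulfI q_neq0); rewrite !step (IHn n.+1 _ (p x) (p x')) -?iterSr //.
by rewrite (IHn n _ (p (p x)) (p (p x'))) -?iterSr // ltnW.
Qed.

Let ratio : R := q%:R `^ (- alpha).

Lemma ratio_gt0 : 0 < ratio. Proof. exact/powR_gt0/q_gt0. Qed.

Lemma weight_gt0 x : 0 < W x. Proof. exact/powR_gt0/q_gt0. Qed.

Lemma weight_parent x : W x = W (p x) * ratio.
Proof.
rewrite /W /weight (hindex_parent treeT ptw horoH0) -powRD; last first.
  by rewrite (gt_eqF q_gt0) implybT.
by rewrite rmorphB /= mulrBr mulr1 subrK.
Qed.

Lemma weight_iter n x : W x = W (iter n p x) * ratio ^+ n.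
Proof.
elim: n => [|n ->]; first by rewrite mulr1.
by rewrite weight_parent -mulrA -exprS.
Qed.

Lemma normc_real (r : R) : Normc.normc (r%:C)%C = `|r|.
Proof. by rewrite /= expr0n addr0 sqrtr_sqr. Qed.

Lemma bergman_mul_summable (f f' : T -> R[i]) :
  bergman adj q w H0 alpha f -> bergman adj q w H0 alpha f' ->
  (\esum_(x in [set: T])
     (Normc.normc (f x * (f' x)^* * (W x)%:C%C))%:E < +oo)%E.
Proof.
move=> [_ finf] [_ finf'].
have nn (u : R[i]) x : (0 <= (Normc.normc u ^+ 2 * W x)%:E)%E.
  by rewrite lee_fin mulr_ge0 ?sqr_ge0 // ltW // weight_gt0.
have := lte_add_pinfty finf finf'.
rewrite -esumD => [fin|x _|x _]; [|exact: nn|exact: nn].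
apply: le_lt_trans fin; apply: le_esum => x _; rewrite -EFinD lee_fin.
rewrite !Normc.normcM normc_real (ger0_norm (ltW (weight_gt0 x))) -mulrDl.
rewrite ler_wpM2r ?(ltW (weight_gt0 _)) //.
have -> : Normc.normc (f' x)^* = Normc.normc (f' x).
  by case: (f' x) => s t; rewrite /= sqrrN.
have n0 (u : R[i]) : 0 <= Normc.normc u by case: u => s t; exact: sqrtr_ge0.
have := n0 (f x); have := n0 (f' x).
move: (Normc.normc _) (Normc.normc _) => s t; nra.
Qed.

(** The q^n points of the level of x below p^n x all contribute the same amount
    to the norm of f. *)
Lemma bergman_radial_eq0 (f : T -> R[i]) : bergman adj q w H0 alpha f ->
  (forall n x x', iter n p x = iter n p x' -> f x = f x') -> f = cst 0.
Proof.
move=> [_ fin] rad; apply/funext => x /=; apply: Normc.eq0_normc.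
apply: contrapT => /eqP nz.
pose G x := Normc.normc (f x) ^+ 2 * W x.
have G0 y : 0 <= G y by rewrite mulr_ge0 ?sqr_ge0 // ltW // weight_gt0.
have Gx : 0 < G x by rewrite mulr_gt0 ?weight_gt0 // exprn_even_gt0.
have [E eE] : exists E, \esum_(x in [set: T]) (G x)%:E = E%:E.
  exists (fine (\esum_(x in [set: T]) (G x)%:E)).
  rewrite fineK // ge0_fin_numE //.
  by apply: esum_ge0 => y _; rewrite lee_fin; exact: G0.
have bound n : n%:R * G x <= E.
  apply: (@le_trans _ _ ((q ^ n)%:R * G x)).
    by rewrite ler_wpM2r // ler_nat ltnW // ltn_expl.
  rewrite -lee_fin -eE.
  have udesc := descendants_uniq ch_uniq mem_ch n (iter n p x).
  apply: le_trans (ler_sum_esum G udesc).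
  rewrite lee_fin (eq_big_seq (fun=> G x)).
    rewrite big_const_seq count_predT (size_descendants size_ch).
    by rewrite iter_addr_0 mulr_natl.
  move=> y; rewrite (mem_descendants mem_ch) => /eqP ey.
  by rewrite /G (rad n y x ey) (weight_iter n y) (weight_iter n x) ey.
have E0 : 0 <= E by have := bound 0%N; rewrite mul0r.
have := archi_boundP (divr_ge0 E0 (G0 x)).
by rewrite ltr_pdivrMr // ltNge bound.
Qed.

Hypothesis alpha1 : 1 < alpha.

Lemma qratio_lt1 : q%:R * ratio < 1.
Proof.
rewrite -{1}(powRr1 (ltW q_gt0)) -powRD; last by rewrite (gt_eqF q_gt0) implybT.
by rewrite /powR (gt_eqF q_gt0) expR_lt1 nmulr_rlt0 ?ln_gt0 ?ltr1n // subr_lt0.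
Qed.

Lemma sum_geometric_le (x : R) n : 0 <= x < 1 ->
  \sum_(0 <= i < n) x ^+ i <= (1 - x)^-1.
Proof.
case/andP=> x0 x1; have d0 : 0 < 1 - x by lra.
rewrite -[leRHS]mul1r ler_pdivlMr //.
have -> : (\sum_(0 <= i < n) x ^+ i) * (1 - x) = 1 - x ^+ n.
  elim: n => [|n IHn]; first by rewrite big_geq // expr0; ring.
  by rewrite big_nat_recr //= mulrDl IHn exprS; ring.
by rewrite gerBl exprn_ge0.
Qed.

(** The level n + 1 below v has q^n points below each successor of v and weight
    q^(- alpha (n + 1)) relative to v, while [coef] is at most 2: the norm is
    dominated by a convergent geometric series. *)
Lemma gfun_bergman v j : bergman adj q w H0 alpha (g (v, j)).
Proof.
split; first exact: gfun_harmonic.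
pose S := \sum_(y <- ch v) Normc.normc (a v j y) ^+ 2.
have S0 : 0 <= S by apply: sumr_ge0 => y _; rewrite sqr_ge0.
have rho0 : 0 <= q%:R * ratio by rewrite mulr_ge0 ?ler0n // ltW // ratio_gt0.
have rho1 := qratio_lt1.
have Wr0 : 0 <= W v * ratio := mulr_ge0 (ltW (weight_gt0 v)) (ltW ratio_gt0).
rewrite (@esum_exhaustion _ _ _ (levels ch v)); first last.
- apply: (levels_exhausts ch_uniq mem_ch iter_inj) => x /= nz.
  apply: contrapT => nx; move/eqP: nz; apply.
  rewrite gfun_out => [|n e]; last by apply: nx; exists n.
  by rewrite Normc.normc0 expr0n mul0r.
- by move=> x; rewrite mulr_ge0 ?sqr_ge0 // ltW // weight_gt0.
pose M := 4 * S * (W v * ratio).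
apply: (@le_lt_trans _ _ (M / (1 - q%:R * ratio))%:E); last exact: ltry.
apply: ge_ereal_sup => _ [n _ <-]; rewrite lee_fin sum_levels.
apply: (@le_trans _ _ (\sum_(0 <= i < n) M * (q%:R * ratio) ^+ i)).
  apply: ler_sum => i _.
  rewrite /M /S mulr_sumr !mulr_suml big_seq [leRHS]big_seq.
  apply: ler_sum => y yv.
  rewrite (eq_big_seq (fun=> coef i.+1 ^+ 2 * Normc.normc (a v j y) ^+ 2 *
    (W v * ratio ^+ i.+1))); last first.
    move=> x; rewrite (mem_descendants mem_ch) => /eqP ex.
    have ev : iter i.+1 p x = v by rewrite iterS ex; apply/eqP; rewrite -mem_ch.
    rewrite (gfun_desc j ev) ex Normc.normcM normc_real ger0_norm ?coef_ge0 //.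
    by rewrite exprMn -/(W x) (weight_iter i.+1 x) ev.
  rewrite big_const_seq count_predT (size_descendants size_ch) iter_addr_0.
  rewrite -[_ *+ (q ^ i)]mulr_natl natrX.
  set X := Normc.normc (a v j y) ^+ 2 * (W v * ratio) * (q%:R * ratio) ^+ i.
  rewrite [leLHS](_ : _ = coef i.+1 ^+ 2 * X); last first.
    by rewrite /X (exprS ratio) exprMn; ring.
  rewrite [leRHS](_ : _ = 2 ^+ 2 * X); last by rewrite -natrX /X !mulrA.
  apply: ler_wpM2r; last by rewrite lerXn2r ?nnegrE ?coef_ge0 ?coef_le2.
  exact: (mulr_ge0 (mulr_ge0 (sqr_ge0 _) Wr0) (exprn_ge0 _ rho0)).
rewrite -mulr_sumr ler_wpM2l ?sum_geometric_le ?rho0 //.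
exact: (mulr_ge0 (mulr_ge0 (ler0n _ 4) S0) Wr0).
Qed.

(** The sum over a level below v is a multiple of the sum over S(v) on the
    right, with a positive factor that depends on the level only: in
    [harmonic_level_sum] the terms in f(v) cancel because a_{v,j} has zero
    sum. *)
Lemma inner_gfun_eq0 (f : T -> R[i]) v j : bergman adj q w H0 alpha f ->
  inner adj q w H0 alpha f (g (v, j)) = 0 <->
  \sum_(y <- ch v) f y * (a v j y)^* = 0.
Proof.
move=> bf; have [/harmonicP harm _] := bf.
pose term i := coef i.+1 * (W v * ratio ^+ i.+1) * (geometric_sum q i.+1)%:R.
have term_ge0 i : 0 <= term i.
  have Wr := mulr_ge0 (ltW (weight_gt0 v)) (exprn_ge0 i.+1 (ltW ratio_gt0)).
  exact: (mulr_ge0 (mulr_ge0 (coef_ge0 _) Wr) (ler0n _ _)).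
apply: (@complex_sum_eq0 _ _ _ (levels ch v)
  (fun n => \sum_(0 <= i < n) term i) (term 0%N)).
- apply: (levels_exhausts ch_uniq mem_ch iter_inj) => x /= nz.
  apply: contrapT => nx; move/eqP: nz; apply.
  rewrite gfun_out => [|n e]; last by apply: nx; exists n.
  by rewrite conjC0 mulr0 mul0r.
- exact: (bergman_mul_summable bf (gfun_bergman v j)).
- move=> n; rewrite sum_levels rmorph_sum mulr_suml; apply: eq_bigr => i _.
  pose k := (coef i.+1 * (W v * ratio ^+ i.+1))%:C%C.
  transitivity (k * \sum_(y <- ch v)
      ((geometric_sum q i.+1)%:R * f y - (geometric_sum q i)%:R * f v) *
      (a v j y)^*).
    rewrite mulr_sumr; apply: eq_big_seq => y yv.
    have pyv : p y = v by apply/eqP; rewrite -mem_ch.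
    rewrite -{2}pyv -(harmonic_level_sum mem_ch size_ch harm).
    rewrite mulr_suml mulr_sumr.
    apply: eq_big_seq => x; rewrite (mem_descendants mem_ch) => /eqP ex.
    have ev : iter i.+1 p x = v by rewrite iterS ex.
    rewrite (gfun_desc j ev) ex rmorphM /= -/(W x) (weight_iter i.+1 x) ev.
    have -> : ((coef i.+1)%:C%C)^* = (coef i.+1)%:C%C :> R[i].
      exact: conjc_real.
    by rewrite /k [in RHS]rmorphM; ring.
  under eq_bigr do rewrite mulrBl -!mulrA.
  rewrite sumrB -!mulr_sumr -raddf_sum sum_onb0 raddf0 !mulr0 subr0 mulrA.
  by congr (_ * _); rewrite /term [RHS]rmorphM /= rmorph_nat.
- rewrite /term coef1 mul1r /geometric_sum big_nat1 expn0 mulr1.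
  exact: (mulr_gt0 (weight_gt0 v) (exprn_gt0 1 ratio_gt0)).
- move=> n n0; rewrite (big_cat_nat (n := 1)) //= big_nat1 lerDl.
  exact: sumr_ge0.
Qed.

Lemma gfun_orthogonal vj vj' : vj <> vj' ->
  inner adj q w H0 alpha (g vj) (g vj') = 0.
Proof.
case: vj vj' => [v j] [v' k] neq.
apply/inner_gfun_eq0; first exact: gfun_bergman.
have [ev|nv] := pselect (v = v').
  rewrite -ev in neq *; rewrite (eq_big_seq (fun y => a v j y * (a v k y)^*)).
    by rewrite sum_onb; case: eqP => // ejk; case: neq; rewrite ejk.
  by move=> y yv; rewrite gfun_child.
have [t et] := gfun_siblings j nv.
rewrite (eq_big_seq (fun y => t * (a v' k y)^*)) => [|y /et -> //].
by rewrite -mulr_sumr -raddf_sum sum_onb0 raddf0 mulr0.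
Qed.

Lemma gfun_complete (f : T -> R[i]) : bergman adj q w H0 alpha f ->
  (forall vj, inner adj q w H0 alpha f (g vj) = 0) -> f = cst 0.
Proof.
move=> bf ort; apply: bergman_radial_eq0 => //.
apply: radial_levels => [|y y' e].
  by case: bf.
apply: (@orthogonal_siblings f (p y')) => // j.
exact/inner_gfun_eq0.
Qed.

End Bergman.

Theorem theorem14 (R : realType) (q : nat) (T : choiceType) (adj : rel T)
    (w : set (nat -> T)) (H0 : set T) (alpha : R)
    (a : T -> 'I_q.-1 -> T -> R[i])
    (hq : (2 <= q)%N) (hT : homogeneous_tree adj q)
    (hw : boundary_point adj w) (hH0 : horocycle adj w H0)
    (halpha : 1 < alpha)
    (ha : forall v : T, zero_sum_onb adj w H0 v (a v)) :
  complete_orthogonal_system adj q w H0 alpha (gfun adj w H0 a).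
Proof.
split.
- by case=> v j; exact: gfun_bergman.
- by move=> vj; exact: (gfun_neq0 hT hw hH0 ha).
- by move=> vj vj'; exact: gfun_orthogonal.
- by move=> f; exact: gfun_complete.
Qed.
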